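(* Let $f$ be an ergodic p.m.p. action of a countable group $\Gamma$ on a standard Borel probability space $(X,\mathcal{B},\mu)$. Then the following are equivalent: 1) $f$ is not strongly ergodic; 2) $f$ is weakly equivalent to $f\times I$.
   Context: A p.m.p. (probability measure preserving) action $f$ of a countable group $\Gamma$ on a standard Borel probability space $(X,\mathcal{B},\mu)$ assigns to each $\gamma\in\Gamma$ a measure preserving Borel transformation $f_\gamma$ of $X$, with $f_{\gamma\delta}=f_\gamma f_\delta$. Weak containment: let $f$ and $g$ be p.m.p. actions of $\Gamma$ on $(X,\mathcal{B},\mu)$ and $(Y,\mathcal{C},\nu)$. Then $f$ weakly contains $g$ if for all Borel subsets $Y_1,\ldots,Y_n\in\mathcal{C}$, every finite set $S\subseteq\Gamma$ and every $\varepsilon>0$ there exist Borel subsets $X_1,\ldots,X_n\in\mathcal{B}$ such that $$\left|\mu(f_\gamma X_i\cap X_j)-\nu(g_\gamma Y_i\cap Y_j)\right|<\varepsilon\quad(1\le i,j\le n,\ \gamma\in S).$$ The actions $f$ and $g$ are weakly equivalent if each weakly contains the other. An action of $\Gamma$ is strongly ergodic if it is ergodic and it does not weakly contain the identity (trivial) action of $\Gamma$ on two points with equal mass. $f\times I$ denotes the diagonal action of $\Gamma$ on $(X,\mathcal{B},\mu)\times[0,1]$ (with Lebesgue measure on $[0,1]$), where $\Gamma$ acts by $f$ on the first coordinate and trivially on the second coordinate. *)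

(* Defs.v *)
From HB Require Import structures.
From mathcomp Require Import all_boot all_order all_algebra.
From mathcomp Require Import all_classical all_reals all_analysis.
Import Order.TTheory GRing.Theory Num.Theory.
Import numFieldNormedType.Exports.

Set Implicit Arguments.
Unset Strict Implicit.
Unset Printing Implicit Defensive.

Local Open Scope classical_set_scope.
Local Open Scope ring_scope.

Definition polish (R : realType) (T : metricType R) : Prop :=
  (forall F : set_system T, ProperFilter F -> cauchy F -> exists x : T, F --> x) /\
  (exists2 D : set T, countable D & dense D).

(* [X] is isomorphic, as a measurable space, to a Polish space equipped with
   the sigma-algebra generated by its open sets. *)
Definition standard_borel (R : realType) d (X : measurableType d) : Prop :=
  exists T : metricType R, polish T /\
  exists2 phi : X -> T, bijective phi &
    forall A : set X, measurable A <-> <<s (@open T) >> (phi @` A).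

Record pmp_action (G : groupType) (R : realType) d (X : measurableType d)
    (mu : probability X R) := PmpAction {
  act :> G -> X -> X ;
  act1 : forall x, act 1%g x = x ;
  actM : forall a b x, act (a * b)%g x = act a (act b x) ;
  measurable_act : forall a, measurable_fun [set: X] (act a) ;
  act_preserving : forall a (A : set X), measurable A ->
    mu (act a @^-1` A) = mu A }.

Definition ergodic (G : groupType) (R : realType) d (X : measurableType d)
    (mu : probability X R) (f : pmp_action G mu) : Prop :=
  forall A : set X, measurable A -> (forall a, f a @` A = A) ->
    mu A = 0%E \/ mu A = 1%E.

Definition weakly_contains (G : groupType) (R : realType)
    d (X : measurableType d) (mu : probability X R)
    d' (Y : measurableType d') (nu : probability Y R)
    (f : pmp_action G mu) (g : pmp_action G nu) : Prop :=
  forall (n : nat) (B : 'I_n -> set Y), (forall i, measurable (B i)) ->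
  forall S : set G, finite_set S ->
  forall eps : R, 0 < eps ->
  exists2 A : 'I_n -> set X, (forall i, measurable (A i)) &
    forall (i j : 'I_n) (a : G), S a ->
      (`| mu ((f a @` A i) `&` A j) - nu ((g a @` B i) `&` B j) | < eps%:E)%E.

Definition weakly_equivalent (G : groupType) (R : realType)
    d (X : measurableType d) (mu : probability X R)
    d' (Y : measurableType d') (nu : probability Y R)
    (f : pmp_action G mu) (g : pmp_action G nu) : Prop :=
  weakly_contains f g /\ weakly_contains g f.

Section trivial_action.
Context (G : groupType) (R : realType) d (X : measurableType d).
Variable mu : probability X R.

Definition trivial_action : pmp_action G mu :=
  @PmpAction G R d X mu (fun _ x => x) (fun _ => erefl) (fun _ _ _ => erefl)
    (fun _ => @measurable_id _ _ _) (fun _ _ _ => erefl).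

End trivial_action.

Definition strongly_ergodic (G : groupType) (R : realType)
    d (X : measurableType d) (mu : probability X R) (f : pmp_action G mu) :
    Prop :=
  ergodic f /\
  ~ weakly_contains f (trivial_action G (bernoulli_prob (2^-1 : R))).

Section product_probability.
Context (R : realType) d1 d2 (X : measurableType d1) (Y : measurableType d2).
Variables (mu : probability X R) (nu : probability Y R).
Local Open Scope ereal_scope.

Let prod := mu \x nu.

HB.instance Definition _ := Measure.on prod.

Let prod_setT : prod setT = 1.
Proof.
rewrite -setXTT [LHS]product_measure1E//.
by rewrite [X in X * _]probability_setT [X in _ * X]probability_setT mule1.
Qed.

HB.instance Definition _ := Measure_isProbability.Build _ _ _ prod prod_setT.

Definition product_probability : probability (X * Y)%type R := prod.

End product_probability.

Section diagonal_action.
Context (G : groupType) (R : realType) d1 d2 (X : measurableType d1)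
  (Y : measurableType d2).
Variables (mu : probability X R) (nu : probability Y R).
Variables (f : pmp_action G mu) (g : pmp_action G nu).

Let diag (a : G) (z : X * Y) : X * Y := (f a z.1, g a z.2).

Let diag1 z : diag 1%g z = z.
Proof. by case: z => x y; rewrite /diag !act1. Qed.

Let diagM a b z : diag (a * b)%g z = diag a (diag b z).
Proof. by rewrite /diag !actM. Qed.

Let measurable_diag a : measurable_fun [set: X * Y] (diag a).
Proof.
apply/measurable_fun_pair => /=.
- exact: measurableT_comp (measurable_act f a) measurable_fst.
- exact: measurableT_comp (measurable_act g a) measurable_snd.
Qed.

Let diag_preserving a (A : set (X * Y)) : measurable A ->
  product_probability mu nu (diag a @^-1` A) = product_probability mu nu A.
Proof.
move=> mA; rewrite /product_probability /= /product_measure1 /=.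
transitivity (\int[mu]_x (nu \o xsection A) (f a x))%E.
  apply: eq_integral => x _ /=.
  rewrite -[RHS](act_preserving g a); last exact: measurable_xsection.
  by congr (nu _); apply/seteqP; split=> y;
    rewrite /xsection /= !inE.
transitivity (\int[pushforward mu (f a)]_x (nu \o xsection A) x)%E.
  rewrite ge0_integral_pushforward//; first exact: measurable_act.
  exact: measurable_fun_xsection.
apply: eq_measure_integral => [|mf B mB _]; first exact: measurable_act.
exact: (act_preserving f).
Qed.

Definition diagonal_action : pmp_action G (product_probability mu nu) :=
  PmpAction diag1 diagM measurable_diag diag_preserving.

End diagonal_action.

Section unit_interval.
Context (R : realType).

Definition unit_interval : Type := set_type `[0%R, 1%R : R].

HB.instance Definition _ := Choice.on unit_interval.

Let zero_in : (0 : R) \in `[0, 1]%classic.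
Proof. by rewrite inE /= in_itv /= lexx ler01. Qed.

HB.instance Definition _ :=
  isPointed.Build unit_interval (SigSub zero_in : set_type _).

Definition unit_interval_val (x : unit_interval) : measurableTypeR R :=
  set_val x.

(* [0, 1] with its Borel sigma-algebra, i.e. the traces of the Borel subsets
   of the real line. *)
Definition borel_unit_interval :=
  g_sigma_algebra_preimageType unit_interval_val.

Definition lebesgue_unit_interval (A : set borel_unit_interval) : \bar R :=
  lebesgue_measure (unit_interval_val @` A).

Let val_inj : injective unit_interval_val.
Proof. by move=> x y; exact: val_inj. Qed.

Let measurable_image (A : set borel_unit_interval) :
  measurable A -> measurable (unit_interval_val @` A).
Proof.
move=> [B mB <-].
suff -> : unit_interval_val @` (setT `&` unit_interval_val @^-1` B) =
    `[0, 1]%classic `&` B.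
  by apply: measurableI => //; exact: measurable_itv.
apply/seteqP; split=> [_ [x [_ Bx] <-]|x [x01 Bx]].
  by split => //; exact: set_valP.
by exists (SigSub (mem_set x01) : set_type _).
Qed.

Let lebesgue0 : lebesgue_unit_interval set0 = 0%E.
Proof. by rewrite /lebesgue_unit_interval image_set0 measure0. Qed.

Let lebesgue_ge0 A : (0 <= lebesgue_unit_interval A)%E.
Proof. exact: measure_ge0. Qed.

Let lebesgue_sigma_additive : semi_sigma_additive lebesgue_unit_interval.
Proof.
move=> F mF tF mUF; rewrite /lebesgue_unit_interval image_bigcup.
apply: measure_semi_sigma_additive.
- by move=> i; exact: measurable_image.
- apply/trivIsetP => i j _ _ ij; rewrite -subset0.
  move=> _ [[x Fx <-] [y Fy /val_inj yx]].
  have : (F i `&` F j) x by split=> //; rewrite -yx.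
  by rewrite (trivIsetP.1 tF i j Logic.I Logic.I ij).
- by rewrite -image_bigcup; exact: measurable_image.
Qed.

HB.instance Definition _ := isMeasure.Build _ _ _ lebesgue_unit_interval
  lebesgue0 lebesgue_ge0 lebesgue_sigma_additive.

Let lebesgue_setT : lebesgue_unit_interval setT = 1%E.
Proof.
rewrite /lebesgue_unit_interval.
suff -> : unit_interval_val @` setT = `[0, 1]%classic.
  by rewrite lebesgue_measure_itv /= lte_fin ltr01 -EFinB subr0.
apply/seteqP; split=> [_ [x _ <-]|x x01]; first exact: set_valP.
by exists (SigSub (mem_set x01) : set_type _).
Qed.

HB.instance Definition _ :=
  Measure_isProbability.Build _ _ _ lebesgue_unit_interval lebesgue_setT.

End unit_interval.

Definition times_I (G : groupType) (R : realType) d (X : measurableType d)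
    (mu : probability X R) (f : pmp_action G mu) :
    pmp_action G (product_probability mu (@lebesgue_unit_interval R)) :=
  diagonal_action f (trivial_action G (@lebesgue_unit_interval R)).

(* Main.v *)
(** If [f] is not strongly ergodic, there are sets of measure about 1/2 that are
    almost invariant.  Along an ultrafilter of more and more invariant such sets
    [C], the limit of [mu (C `&` P)], as a function of [P], is an invariant
    measure dominated by [mu], and a Hahn decomposition together with ergodicity
    shows that it is [mu / 2]: almost invariant sets become independent of any
    given finite family of sets.  Intersecting such sets gives, for [K = 2 ^ N],
    an almost invariant labelling [c : X -> {0, .., K - 1}] whose fibers are
    almost independent of a given finite family.  For points [t 0, .., t (K - 1)]
    whose empirical measure integrates well the finitely many functions
    [y |-> mu (ysection W y)], with [W = (f x I)_a (B i) `&` B j], the sets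
    [A i = {x | (x, t (c x)) \in B i}] witness that [f] weakly contains
    [f x I]. *)

From HB Require Import structures.
Require Import Defs.
From mathcomp Require Import all_boot all_order all_algebra.
From mathcomp Require Import all_classical all_reals all_analysis.
From mathcomp Require Import measurable_realfun lra.
Import Order.TTheory GRing.Theory Num.Theory.
Import numFieldNormedType.Exports.

Set Implicit Arguments.
Unset Strict Implicit.
Unset Printing Implicit Defensive.

Local Open Scope classical_set_scope.
Local Open Scope ring_scope.

(** * Real-valued probabilities and charges dominated by one *)

Section real_valued_probability.
Context (R : realType) d (X : measurableType d) (mu : probability X R).
Local Notation m A := (fine (mu A)).
Implicit Types A B C : set X.

Lemma prob_fineK A : measurable A -> mu A = (m A)%:E.
Proof. by move=> mA; rewrite fineK// fin_num_measure. Qed.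

Lemma prob_ge0 A : 0 <= m A.
Proof. exact/fine_ge0/measure_ge0. Qed.

Lemma probU A B : measurable A -> measurable B -> A `&` B = set0 ->
  m (A `|` B) = m A + m B.
Proof.
by move=> mA mB AB0; rewrite measureU// fineD// fin_num_measure.
Qed.

Lemma prob_le A B : measurable A -> measurable B -> A `<=` B -> m A <= m B.
Proof.
by move=> mA mB AB; rewrite fine_le ?fin_num_measure// le_measure ?inE.
Qed.

Lemma prob_le1 A : measurable A -> m A <= 1.
Proof.
by move=> mA; rewrite -lee_fin -prob_fineK// probability_le1.
Qed.

Lemma probDI A B : measurable A -> measurable B ->
  m A = m (A `\` B) + m (A `&` B).
Proof.
move=> mA mB; rewrite -probU 1?setUC ?setUIDK//.
- exact: measurableD.
- exact: measurableI.
- by rewrite setDE setIACA setICl setI0.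
Qed.

Lemma probU_le A B : measurable A -> measurable B -> m (A `|` B) <= m A + m B.
Proof.
move=> mA mB; rewrite -lee_fin EFinD -!prob_fineK//; last exact: measurableU.
exact: measureU2.
Qed.

Lemma measurable_setY A B : measurable A -> measurable B ->
  measurable (A `+` B).
Proof. by move=> mA mB; apply: measurableU; exact: measurableD. Qed.

Lemma prob_distY A B : measurable A -> measurable B ->
  `|m A - m B| <= m (A `+` B).
Proof.
move=> mA mB.
have mAB := measurableD mA mB; have mBA := measurableD mB mA.
rewrite /setY probU//; last first.
  by apply/seteqP; split=> // x [[? ?] [? ?]].
rewrite (probDI mA mB) (probDI mB mA) (setIC B A).
have := prob_ge0 (A `\` B); have := prob_ge0 (B `\` A).
rewrite ler_norml => *; apply/andP; split; lra.
Qed.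

(** Sigma-additivity follows from the domination: the value of [s] on the tail of a disjoint union
    is at most the measure of that tail, which tends to 0. A limit of measures along an ultrafilter,
    a priori only finitely additive, thus becomes a charge with a Hahn decomposition. *)
Lemma dominated_charge (s : set X -> R) :
  (forall A B, measurable A -> measurable B -> A `&` B = set0 ->
    s (A `|` B) = s A + s B) ->
  (forall A, measurable A -> `|s A| <= m A) ->
  exists nu : {charge set X -> \bar R}, forall A, nu A = (s A)%:E.
Proof.
move=> sU sle.
have s0 : s set0 = 0.
  by apply/eqP; rewrite -normr_le0 (le_trans (sle _ _))// measure0.
have ssum (F : nat -> set X) n : (forall i, measurable (F i)) -> trivIset setT F ->
    s (\big[setU/set0]_(i < n) F i) = \sum_(0 <= i < n) s (F i).
  move=> mF tF; elim: n => [|n IHn]; first by rewrite big_ord0 big_geq.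
  rewrite big_ord_recr sU ?IHn ?big_nat_recr//=; first exact: bigsetU_measurable.
  by rewrite big_distrl/= big1// => i _; apply: (trivIsetP.1 tF) => //;
    rewrite neq_ltn ltn_ord.
have ssa : semi_sigma_additive (fun A => (s A)%:E).
  move=> F mF tF mUF.
  under eq_fun do rewrite sumEFin.
  apply: cvg_EFin; first exact: nearW.
  rewrite -[_ \o _]/(fun n => \sum_(0 <= i < n) s (F i)).
  pose Un n := \big[setU/set0]_(i < n) F i.
  have mUn n : measurable (Un n) by exact: bigsetU_measurable.
  have cm : (fun n => m (\bigcup_i F i) - m (Un n)) @ \oo --> (0 : R).
    rewrite -[X in _ --> X](subrr (m (\bigcup_i F i))).
    apply: cvgB; first exact: cvg_cst.
    apply: fine_cvg; rewrite -prob_fineK//.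
    rewrite (_ : (fun n => mu (Un n)) = fun n => (\sum_(0 <= i < n) mu (F i))%E).
      exact: (@measure_semi_sigma_additive _ _ _ mu).
    by apply/funext => n; rewrite big_mkord measure_semi_additive//; exact: mUn.
  move/cvgrPdist_lt : cm => cm; apply/cvgrPdist_lt => e /cm.
  apply: filterS => n; rewrite sub0r normrN => /(le_lt_trans _); apply.
  have mD : measurable (\bigcup_i F i `\` Un n) by exact: measurableD.
  have UnF : Un n `<=` \bigcup_i F i by exact: bigsetU_bigcup.
  have UE : Un n `|` (\bigcup_i F i `\` Un n) = \bigcup_i F i.
    exact: setDUK.
  have UD0 : Un n `&` (\bigcup_i F i `\` Un n) = set0 by rewrite setDIK.
  rewrite -{1}UE sU// /Un ssum// -/(Un n) addrAC subrr add0r.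
  rewrite -[in leRHS]UE probU// addrAC subrr add0r.
  by rewrite (le_trans (sle _ _))// ler_norm.
pose sE A := (s A)%:E.
pose c := isCharge.Build _ X R sE (congr1 EFin s0) (fun _ _ => isT) ssa.
pose nu : {charge set X -> \bar R} := HB.pack sE c.
by exists nu.
Qed.

End real_valued_probability.

(** Compactness of the segment gives a cluster point, and an ultrafilter converges to each of its
    cluster points. *)
Lemma ultra_bounded_cvg (R : realType) (T : Type) (U : set_system T)
    (UU : UltraFilter U) (h : T -> R) (a b : R) :
  (\forall x \near U, a <= h x <= b) -> cvg (h @ U).
Proof.
move=> hab; apply/cvg_ex => /=.
have [|p [_ clp]] := @segment_compact R a b (h @ U) _.
  by apply: filterS hab => x; rewrite /= in_itv.
exists p => A nA.
have [//|UA] := in_ultra_setVsetC (h @^-1` A) UU.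
by have [x []] := clp (~` A) A UA nA.
Qed.

(** * Images and preimages under the action *)

Section pmp_action.
Context (R : realType) (G : groupType) d (X : measurableType d)
  (mu : probability X R) (f : pmp_action G mu).
Local Notation m A := (fine (mu A)).

Lemma actK a x : f a (f a^-1%g x) = x.
Proof. by rewrite -actM mulgV act1. Qed.

Lemma actVK a x : f a^-1%g (f a x) = x.
Proof. by rewrite -actM mulVg act1. Qed.

Lemma image_act a (A : set X) : f a @` A = f a^-1%g @^-1` A.
Proof.
apply/seteqP; split=> [_ [x Ax <-]|x Ax]; first by rewrite /= actVK.
by exists (f a^-1%g x) => //; rewrite actK.
Qed.

Lemma measurable_preimage_act a (A : set X) :
  measurable A -> measurable (f a @^-1` A).
Proof. by move=> mA; rewrite -[X in measurable X]setTI; exact: measurable_act. Qed.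

Lemma prob_preimage_act a (A : set X) : measurable A -> m (f a @^-1` A) = m A.
Proof. by move=> mA; rewrite act_preserving. Qed.

End pmp_action.

(** * Limits of almost invariant sets along an ultrafilter *)

Section limit_of_almost_invariant_sets.
Context (R : realType) (G : groupType) d (X : measurableType d)
  (mu : probability X R) (f : pmp_action G mu).
Hypotheses (cG : countable [set: G]) (ef : ergodic f).
Local Notation m A := (fine (mu A)).

(** The union of all translates of [N] is invariant; countability of [G] keeps it measurable and
    negative, and ergodicity makes it null or conull. *)
Lemma invariant_negative_set (nu : {charge set X -> \bar R}) (N : set X) :
  (forall a A, measurable A -> nu (f a @^-1` A) = nu A) ->
  negative_set nu N ->
  exists D, [/\ negative_set nu D, N `<=` D & mu D = 0%E \/ mu D = 1%E].
Proof.
move=> nuf [mN negN].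
have [e eT] : exists e : nat -> G, range e = setT.
  have /pfcard_geP[G0|[e]] := cG; last by exists e; exact: image_eq.
  by have : [set: G] 1%g by []; rewrite G0.
have preN n : negative_set nu (f (e n) @^-1` N).
  split=> [|A mA AN]; first exact: measurable_preimage_act.
  rewrite -(nuf (e n)^-1%g)//; apply: negN.
    exact: measurable_preimage_act.
  by move=> x /AN /=; rewrite actK.
have ND := bigcup_negative_set preN.
exists (\bigcup_n f (e n) @^-1` N); split=> //.
  have [n _ en] : range e 1%g by rewrite eT.
  by move=> x Nx; exists n => //=; rewrite en act1.
apply: ef; first by case: ND.
move=> a; rewrite image_act; apply/seteqP; split=> x [n _ /= Nx].
  have [k _ ek] : range e (e n * a^-1)%g by rewrite eT.
  by exists k => //=; rewrite ek actM.
have [k _ ek] : range e (e n * a)%g by rewrite eT.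
by exists k => //=; rewrite ek actM actK.
Qed.

Lemma ultra_almost_invariant_cvg (U : set_system (set X)) (UU : UltraFilter U) :
  (\forall C \near U, measurable C) ->
  (forall a e, 0 < e -> \forall C \near U, m ((f a @^-1` C) `+` C) < e) ->
  m C @[C --> U] --> (2^-1 : R) ->
  forall P, measurable P -> m (C `&` P) @[C --> U] --> m P / 2.
Proof.
move=> mU invU halfU.
pose h P C := m (C `&` P).
have h01 P : measurable P -> \forall C \near U, 0 <= h P C <= m P.
  move=> mP; near=> C; rewrite prob_ge0/= prob_le//.
    by apply: measurableI => //; near: C.
have hcvg P : measurable P -> cvg (h P @ U).
  by move=> mP; exact: ultra_bounded_cvg (h01 _ mP).
(* [s] is the deviation of the limit from its claimed value; it has to vanish on measurable sets. *)
pose s P := lim (h P @ U) - m P / 2.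
have sU A B : measurable A -> measurable B -> A `&` B = set0 ->
    s (A `|` B) = s A + s B.
  move=> mA mB AB0; rewrite /s probU//.
  suff -> : lim (h (A `|` B) @ U) = lim (h A @ U) + lim (h B @ U) by lra.
  apply/cvg_lim => //; apply: cvg_trans (cvgD (hcvg _ mA) (hcvg _ mB)).
  apply: near_eq_cvg; near=> C; have mC : measurable C by near: C.
  rewrite /h/= setIUr [RHS]probU//; try exact: measurableI.
  by rewrite setIACA AB0 setI0.
have sle A : measurable A -> `|s A| <= m A.
  move=> mA; rewrite /s.
  have l0 : 0 <= lim (h A @ U).
    apply: limr_ge; first exact: hcvg.
    by apply: filterS (h01 _ mA) => C /andP[].
  have l1 : lim (h A @ U) <= m A.
    apply: limr_le; first exact: hcvg.
    by apply: filterS (h01 _ mA) => C /andP[].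
  have := prob_ge0 mu A; rewrite ler_norml => *; apply/andP; split; lra.
have sf a A : measurable A -> s (f a @^-1` A) = s A.
  move=> mA; rewrite /s prob_preimage_act//; congr (_ - _).
  have mfA : measurable (f a @^-1` A) by exact: measurable_preimage_act.
  apply/cvg_lim => //.
  (* Pulling [C] and [A] back together preserves the measure of their intersection, so the two terms
     differ by at most the measure of the symmetric difference of [C] and its pullback. *)
  have c0 : h (f a @^-1` A) C - h A C @[C --> U] --> (0 : R).
    apply/cvgrPdist_lt => e e0; near=> C.
    have mC : measurable C by near: C.
    have mfC : measurable (f a @^-1` C) by exact: measurable_preimage_act.
    have CE : m ((f a @^-1` C) `+` C) < e by near: C; exact: invU.
    rewrite sub0r normrN; apply: le_lt_trans CE.
    rewrite /h -(prob_preimage_act f a (measurableI _ _ mC mA)).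
    rewrite preimage_setI distrC.
    apply: le_trans (prob_distY _ _ _) _; [exact: measurableI..|].
    apply: prob_le.
    - by apply: measurable_setY; exact: measurableI.
    - exact: measurable_setY.
    - by rewrite -setIYl; exact: subIsetl.
  rewrite -[X in _ --> X]add0r; apply: cvg_trans (cvgD c0 (hcvg _ mA)).
  by apply: near_eq_cvg; near=> C; rewrite /= subrK.
(* The saturation of a Hahn negative set of [s] is still negative; being
   invariant it is null or conull, so [s] has constant sign, and [s] vanishes on
   the whole space. *)
have [nu nuE] := dominated_charge sU sle.
have sT : s setT = 0.
  rewrite /s probability_setT/= mul1r; apply/eqP; rewrite subr_eq0; apply/eqP.
  rewrite (_ : h setT = fun C => m C); first exact/cvg_lim.
  by apply/funext => C; rewrite /h setIT.
have s0 A : measurable A -> m A = 0 -> s A = 0.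
  by move=> mA A0; apply/eqP; rewrite -normr_le0 -A0 sle.
have sC A : measurable A -> s A + s (~` A) = 0.
  move=> mA; rewrite -sU ?setUv ?setICr//; exact: measurableC.
have sD A B : measurable A -> measurable B -> s A = s (A `&` B) + s (A `\` B).
  move=> mA mB; rewrite -sU.
  - by rewrite setUIDK.
  - exact: measurableI.
  - exact: measurableD.
  - by apply/seteqP; split=> // x [[_ ?] [_]].
have [Q [N [[_ posQ] negN QNT _]]] := Hahn_decomposition nu.
have mN : measurable N by case: negN.
have QA A : A `\` N `<=` Q.
  move=> x [_ Nx]; have [//|/Nx[]] : (Q `|` N) x by rewrite QNT.
have nuf a A : measurable A -> nu (f a @^-1` A) = nu A.
  by move=> mA; rewrite !nuE sf.
have [D [[mD negD] ND D01]] := invariant_negative_set nuf negN.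
have sA0 : forall A, measurable A -> s A = 0.
  (* One sign suffices: [s] takes opposite values on [A] and on its complement. *)
  suff : (forall A, measurable A -> 0 <= s A) \/ (forall A, measurable A -> s A <= 0).
    move=> [s_sgn|s_sgn] A mA; have := s_sgn A mA; have := s_sgn (~` A) (measurableC mA);
      have := sC A mA; lra.
  have m0 B C : measurable B -> measurable C -> B `<=` C -> m C = 0 -> s B = 0.
    move=> mB mC BC C0; apply: s0 => //; apply/eqP; rewrite eq_le prob_ge0 andbT.
    by rewrite -C0 prob_le.
  (* If [D] is null then so is [N], and up to a null set [A] lies in the positive set [Q]; if [D] is
     conull, then up to a null set [A] lies in the negative set [D]. *)
  case: D01 => D01; [left|right] => A mA.
    rewrite (sD A N)// (@m0 (A `&` N) D) ?D01 ?add0r//.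
    - rewrite -lee_fin -nuE; apply: posQ (QA A); exact: measurableD.
    - exact: measurableI.
    - exact: subset_trans (@subIsetr _ _ _) ND.
  rewrite (sD A D)// (@m0 (A `\` D) (~` D)) ?addr0//.
  - by rewrite -lee_fin -nuE; apply: negD => //; exact: measurableI.
  - exact: measurableD.
  - exact: measurableC.
  - by rewrite probability_setC// D01 subee.
move=> P mP.
have -> : m P / 2 = lim (h P @ U) by have := sA0 P mP; rewrite /s; lra.
exact: hcvg.
Unshelve. all: by end_near.
Qed.

End limit_of_almost_invariant_sets.

(** If the preimage of some neighbourhood [W] of [l] is not in [F], then [F] and the complement of
    that preimage generate a proper filter, and an ultrafilter above it contradicts the
    hypothesis. *)
Lemma cvg_ultra (T : Type) (V : topologicalType) (F : set_system T)
    (FF : ProperFilter F) (h : T -> V) (l : V) :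
  (forall U, UltraFilter U -> F `<=` U -> h @ U --> l) -> h @ F --> l.
Proof.
move=> hU W Wl; apply: contrapT => nFW.
have GP : ProperFilter (within (~` (h @^-1` W)) F).
  apply: Build_ProperFilter => G0; apply: nFW.
  have {}G0 : F [set x | ~ W (h x) -> False] := G0.
  by apply: (filterS _ G0) => x; exact: contrapT.
have [U [UU GU]] := ultraFilterLemma GP.
have FU : F `<=` U by move=> A FA; apply: GU; exact: filterS FA.
have UW : U (h @^-1` W) by exact: hU.
have UnW : U (~` (h @^-1` W)) by apply: GU; exact: withinT.
by have /filter_ex[x []] : U (h @^-1` W `&` ~` (h @^-1` W)) by exact: filterI.
Qed.

(** * Almost invariant sets almost independent of given sets *)

Section mixing_almost_invariant_set.
Context (R : realType) (G : groupType) d (X : measurableType d)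
  (mu : probability X R) (f : pmp_action G mu).
Hypotheses (cG : countable [set: G]) (ef : ergodic f).
Hypothesis fbool : weakly_contains f (trivial_action G (bernoulli_prob (2^-1 : R))).
Local Notation m A := (fine (mu A)).

(** The finite list and the tolerance form a single index so that these families are the base of a
    filter on the subsets of [X]. *)
Definition almost_invariant_half (p : seq G * R) : set (set X) :=
  [set C | [/\ measurable C, `|m C - 2^-1| < p.2 &
    forall a, a \in p.1 -> m ((f a @^-1` C) `+` C) < p.2]].

(** The witness [C] mimics the atom [true] of mass 1/2. If [q] is the measure of the intersection of
    [C] and its pullback, their symmetric difference has measure [2 * (m C - q)]; this is below [e],
    since [m C] and [q] are both within [e / 4] of 1/2. *)
Lemma almost_invariant_half_neq0 p : 0 < p.2 -> almost_invariant_half p !=set0.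
Proof.
case: p => s e /= e0.
have e4 : 0 < e / 4 by lra.
have mt : measurable [set true] by [].
(* The element 1 controls [m C]; inverses are taken because the image under [a^-1] is the preimage
   under [a]. *)
have [A mA Ae] := @fbool 1%N (fun=> [set true]) (fun=> mt)
  _ (finite_seq (1%g :: [seq a^-1%g | a <- s])) _ e4.
have bE : bernoulli_prob (2^-1 : R) ([set true] `&` [set true]) = (2^-1)%:E.
  rewrite setIid /bernoulli_prob ifT ?fsbig_set1//.
  by rewrite invr_ge0 ler0n/= invf_le1// ler1n.
pose C := A ord0; have mC : measurable C := mA ord0.
have Ce a : a \in 1%g :: [seq a^-1%g | a <- s] ->
    `|m ((f a^-1%g @^-1` C) `&` C) - 2^-1| < e / 4.
  move=> sa; have := Ae ord0 ord0 a sa; rewrite image_id [X in (_ - X)%E]bE image_act.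
  rewrite prob_fineK; last by apply: measurableI => //; exact: measurable_preimage_act.
  by rewrite -EFinB lte_fin.
have Ce1 : `|m C - 2^-1| < e / 4.
  have := Ce 1%g (mem_head _ _); rewrite invg1.
  by rewrite (_ : f 1%g @^-1` C = C) ?setIid//; apply/seteqP; split=> x /=; rewrite act1.
exists C; split => //=; first by apply: lt_trans Ce1 _; lra.
move=> a sa.
have mfC : measurable (f a @^-1` C) by exact: measurable_preimage_act.
have : `|m ((f a @^-1` C) `&` C) - 2^-1| < e / 4.
  by rewrite -{1}(invgK a); apply: Ce; rewrite inE map_f ?orbT.
have := probDI mu mfC mC; have := probDI mu mC mfC.
rewrite (setIC C) prob_preimage_act// /setY probU; last 3 first.
- exact: measurableD.
- exact: measurableD.
- by apply/seteqP; split=> // x [[? ?] []].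
move: Ce1; rewrite !ltr_norml => /andP[? ?] ? ? /andP[? ?]; lra.
Qed.

Lemma almost_invariant_half_filter :
  ProperFilter (filter_from [set p | 0 < p.2] almost_invariant_half).
Proof.
apply: filter_from_proper; last exact: almost_invariant_half_neq0.
apply: filter_from_filter; first by exists ([::], 1) => /=.
move=> [s e] [s' e'] /= e0 e0'; exists (s ++ s', Num.min e e') => /=.
  by rewrite lt_min e0.
move=> C [mC /=]; rewrite lt_min => /andP[Ce Ce'] Cs.
by split; split=> // a sa; have := Cs a; rewrite mem_cat sa ?orbT lt_min => /(_ isT)/andP[].
Qed.

(** Every ultrafilter above the filter of almost invariant halves gives the limit [m (P i) / 2],
    hence so does the filter itself; finitely many conditions then hold together on a member of it,
    which is nonempty. *)
Lemma exists_mixing_almost_invariant (I : finType) (P : I -> set X) (s : seq G)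
    (e : R) : (forall i, measurable (P i)) -> 0 < e ->
  exists D, [/\ measurable D,
    forall i, `|m (D `&` P i) - m (P i) / 2| < e &
    forall a, a \in s -> m ((f a @^-1` D) `+` D) < e].
Proof.
move=> mP e0.
pose F := filter_from [set p | 0 < p.2] almost_invariant_half.
have FF : ProperFilter F := almost_invariant_half_filter.
have Fp p : 0 < p.2 -> F (almost_invariant_half p) by move=> p0; exists p.
have Fe : \forall C \near F, almost_invariant_half (s, e) C by exact: Fp.
have FP : \forall C \near F, forall i, `|m (C `&` P i) - m (P i) / 2| < e.
  apply: filter_forall => i.
  suff /cvgrPdist_lt/(_ e e0) : m (C `&` P i) @[C --> F] --> m (P i) / 2.
    by apply: filterS => C; rewrite distrC.
  apply: cvg_ultra => U UU sFU; apply: (@ultra_almost_invariant_cvg _ _ _ _ _ f) => //.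
  - by apply: sFU; apply: filterS (Fp ([::], 1) ltr01) => C [].
  - move=> a r r0; apply: sFU; apply: filterS (Fp ([:: a], r) r0) => C [_ _].
    by apply; rewrite mem_head.
  - apply/cvgrPdist_lt => r r0; apply: sFU.
    by apply: filterS (Fp ([::], r) r0) => C [_ + _]; rewrite distrC.
have [D [[mD _ Ds] DP]] := filter_ex (filterI Fe FP).
by exists D.
Qed.

End mixing_almost_invariant_set.

(** * Almost invariant labellings *)

Section mixing_almost_invariant_labelling.
Context (R : realType) (G : groupType) d (X : measurableType d)
  (mu : probability X R) (f : pmp_action G mu).
Local Notation m A := (fine (mu A)).

Lemma measurable_label_neq (c : X -> nat) a :
  (forall k, measurable (c @^-1` [set k])) ->
  measurable [set x | c (f a x) <> c x].
Proof.
move=> mc; rewrite -[X in measurable X]setCK; apply: measurableC.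
rewrite (_ : ~` _ = \bigcup_k ((f a @^-1` (c @^-1` [set k])) `&` c @^-1` [set k])).
  apply: bigcup_measurable => k _; apply: measurableI => //.
  exact: measurable_preimage_act.
apply/seteqP; split=> [x /contrapT cx|x [k _ [/= -> ->]]]; last by rewrite /= => /(_ erefl).
by exists (c x).
Qed.

Hypotheses (cG : countable [set: G]) (ef : ergodic f).
Hypothesis fbool : weakly_contains f (trivial_action G (bernoulli_prob (2^-1 : R))).

(** By induction on [n]: all label classes are split in two by a single almost invariant set [D],
    almost independent of every intersection of a label class with some [P i]. *)
Lemma exists_mixing_labelling n (I : finType) (P : I -> set X) (s : seq G)
    (e : R) : (forall i, measurable (P i)) -> 0 < e ->
  exists c : X -> nat, [/\ forall k, measurable (c @^-1` [set k]),
    forall x, (c x < 2 ^ n)%N,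
    forall i k, (k < 2 ^ n)%N ->
      `|m ((c @^-1` [set k]) `&` P i) - m (P i) / (2 ^ n)%:R| < e &
    forall a, a \in s -> m [set x | c (f a x) <> c x] < e].
Proof.
move=> mP; elim: n e => [|n IHn] e e0.
  have c0 k : measurable ((fun _ : X => 0%N) @^-1` [set k]).
    by rewrite preimage_cst; case: ifP.
  exists (fun=> 0%N); split=> // [i k|a _].
    rewrite expn0 ltnS leqn0 divr1 => /eqP->.
    by rewrite preimage_cst mem_set// setTI subrr normr0.
  by rewrite (_ : [set _ | _] = set0) ?measure0//; apply/seteqP; split=> x /=.
(* The new label moves only where the old one or membership in [D] does, so two invariance defects
   below [e / 2] add up. *)
have e2 : 0 < e / 2 by lra.
have [c [mc cn cP cs]] := IHn _ e2.
have mQ (ik : I * 'I_(2 ^ n)) : measurable ((c @^-1` [set (ik.2 : nat)]) `&` P ik.1).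
  exact: measurableI.
have [D [mD DP Ds]] := exists_mixing_almost_invariant cG ef fbool s mQ e2.
pose c' x := ((x \in D) + (c x).*2)%N.
have c'E k : c' @^-1` [set k] =
    (c @^-1` [set k./2]) `&` (if odd k then D else ~` D).
  apply/seteqP; split=> x /=.
    by move=> <-; rewrite half_bit_double oddD odd_double addbF oddb; split=> //;
      case: ifPn; rewrite ?inE ?notin_setE.
  move=> [cx Dx]; rewrite /c' cx -[RHS]odd_double_half; congr (_ + _)%N.
  by case: ifP Dx => _ Dx; rewrite ?(mem_set Dx)// memNset.
have mc' k : measurable (c' @^-1` [set k]).
  by rewrite c'E; apply: measurableI => //; case: ifP => _ //; exact: measurableC.
exists c'; split=> // [x|i k kn|a sa].
- rewrite /c' expnS mul2n (@leq_ltn_trans (1 + (c x).*2))//.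
    by rewrite leq_add2r leq_b1.
  by rewrite add1n ltn_Sdouble.
- have kn2 : (k./2 < 2 ^ n)%N by rewrite ltn_half_double -mul2n -expnS.
  have := DP (i, Ordinal kn2) => /=; have := cP i _ kn2.
  set Q := (_ @^-1` _) `&` P i; have mQ' : measurable Q by exact: measurableI.
  have -> : c' @^-1` [set k] `&` P i = if odd k then D `&` Q else Q `\` D.
    by rewrite c'E /Q; case: ifP => _; rewrite ?setDE setIAC//= setIC// setIA.
  rewrite expnS natrM.
  have -> : m (P i) / (2 * (2 ^ n)%:R) = m (P i) / (2 ^ n)%:R / 2.
    by rewrite invfM mulrA mulrAC.
  have := probDI mu mQ' mD; rewrite (setIC Q).
  case: ifP => _; rewrite !ltr_norml => ? /andP[? ?] /andP[? ?]; lra.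
- have ? := measurable_label_neq a mc.
  have ? : measurable ((f a @^-1` D) `+` D).
    by apply: measurable_setY => //; exact: measurable_preimage_act.
  apply: (@le_lt_trans _ _ (m ([set x | c (f a x) <> c x] `|` ((f a @^-1` D) `+` D)))).
    apply: prob_le; [exact: measurable_label_neq|exact: measurableU|].
    move=> x /= c'x; apply: contrapT => /not_orP[/contrapT cx Dx].
    apply: c'x; rewrite /c' cx; congr (_ + _)%N; congr nat_of_bool.
    by apply/idP/idP; rewrite !inE => ?; apply: contrapT => ?; apply: Dx; [left|right].
  apply: le_lt_trans (probU_le _ _ _) _ => //.
  by have := cs a sa; have := Ds a sa; lra.
Qed.

End mixing_almost_invariant_labelling.

(** * Greedy choice of sample points *)

Section greedy_sampling.
Context (R : realType) d (Y : measurableType d) (nu : probability Y R).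
Context (I : finType) (phi : I -> Y -> R).
Hypothesis mphi : forall i, measurable_fun setT (phi i).
Hypothesis phi01 : forall i y, 0 <= phi i y <= 1.
Let M i := \int[nu]_y phi i y.

Let iphi i : nu.-integrable setT (EFin \o phi i).
Proof.
apply: measurable_bounded_integrable => //.
  by rewrite [X in (X < _)%E]probability_setT ltry.
exists 1; split; first exact: num_real.
move=> r r1 y _ /=; have /andP[p0 p1] := phi01 i y.
by rewrite ger0_norm// (le_trans p1)// ltW.
Qed.

Let iM r : nu.-integrable setT (EFin \o cst r).
Proof. exact: finite_measure_integrable_cst. Qed.

Let iphiM i : nu.-integrable setT (EFin \o (fun y => phi i y - M i)).
Proof.
rewrite (_ : _ \o _ = (EFin \o phi i) \- (EFin \o cst (M i)))%E//.
exact: integrableB.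
Qed.

Lemma prob_cst r : \int[nu]_y r = r.
Proof. by rewrite Rintegral_cst// [X in fine X]probability_setT mulr1. Qed.

Lemma mean_ge0_le1 i : 0 <= M i <= 1.
Proof.
apply/andP; split.
  by apply: Rintegral_ge0 => y _; have /andP[] := phi01 i y.
rewrite -[leRHS]prob_cst; apply: le_Rintegral => //; first exact: iM.
by move=> y _; have /andP[] := phi01 i y.
Qed.

(** The sum has mean 0, so it cannot exceed 1/2 everywhere. The positive slack makes a non-strict
    comparison of integrals contradictory; doubled in the expansion of a square, it gives the [+ 1]
    in [exists_sample]. *)
Lemma exists_le_mean (v : I -> R) :
  exists y, \sum_i v i * (phi i y - M i) <= 2^-1.
Proof.
apply: contrapT => /forallNP nv.
pose h i y := v i * (phi i y - M i).
have ih i : nu.-integrable setT (EFin \o h i).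
  rewrite (_ : _ \o _ = fun y => (v i)%:E * (phi i y - M i)%:E)%E//.
  exact: (integrableZl measurableT (v i) (iphiM i)).
have h0 i : \int[nu]_y h i y = 0.
  rewrite RintegralZl// RintegralB//; last exact: iM.
  by rewrite prob_cst subrr mulr0.
have : \int[nu]_y (2^-1 : R) <= \int[nu]_y \sum_i h i y.
  apply: le_Rintegral => //; first exact: iM.
    rewrite (_ : _ \o _ = fun y => \sum_i (h i y)%:E)%E; last first.
      by apply/funext => y; rewrite /= sumEFin.
    exact: (integrable_sum measurableT _ (fun i _ => ih i)).
  by move=> y _; rewrite leNgt; apply/negP => hy; apply: (nv y); exact: ltW.
rewrite prob_cst /Rintegral.
under eq_integral do rewrite -sumEFin.
rewrite integral_sum// big1 => [|i _]; first by rewrite /= leNgt invr_gt0 ltr0n.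
have := integrable_fin_num measurableT (ih i).
by move/fineK => <-; congr EFin; exact: h0.
Qed.

(* Each new point is chosen so that its deviation has (almost) nonpositive
   scalar product with the accumulated one; the squared norm of the accumulated
   deviation then grows only linearly. *)
Lemma exists_sample n : exists t : nat -> Y,
  \sum_i (\sum_(k < n) (phi i (t k) - M i)) ^+ 2 <= n%:R * (#|I|%:R + 1).
Proof.
elim: n => [|n [t tn]].
  have [y _] := exists_le_mean (fun=> 0).
  exists (fun=> y); rewrite mul0r big1// => i _.
  by rewrite big_ord0 expr0n.
have [y yn] := exists_le_mean (fun i => \sum_(k < n) (phi i (t k) - M i)).
exists (fun k => if (k < n)%N then t k else y).
pose S i := \sum_(k < n) (phi i (t k) - M i).
rewrite (eq_bigr (fun i => S i ^+ 2 + 2 * (S i * (phi i y - M i)) +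
    (phi i y - M i) ^+ 2)); last first.
  move=> i _; rewrite big_ord_recr/= ltnn.
  under eq_bigr do rewrite ltn_ord.
  by rewrite -/(S i) sqrrD -mulr_natl.
rewrite !big_split/= -mulr_sumr.
have : \sum_i (phi i y - M i) ^+ 2 <= #|I|%:R.
  rewrite -sum1_card natr_sum; apply: ler_sum => i _.
  rewrite -real_normK ?num_real// expr_le1// ler_norml.
  have := phi01 i y; have := mean_ge0_le1 i => /andP[? ?] /andP[? ?].
  apply/andP; split; lra.
move: tn yn; rewrite -[n.+1%:R]natr1 mulrDl mul1r.
rewrite -[\sum_i _ ^+ 2 <= n%:R * _]/(\sum_i S i ^+ 2 <= _).
rewrite -[\sum_i _ <= 2^-1]/(\sum_i S i * (phi i y - M i) <= _).
lra.
Qed.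

End greedy_sampling.

(** * Sets glued along a labelling *)

Section labelling.
Context (R : realType) d (X : measurableType d) (mu : probability X R).
Local Notation m A := (fine (mu A)).
Context (c : X -> nat) (N : nat) (Q : nat -> set X).
Hypothesis mc : forall k, measurable (c @^-1` [set k]).
Hypothesis cN : forall x, (c x < N)%N.
Hypothesis mQ : forall k, measurable (Q k).

Let glueE : [set x | Q (c x) x] =
  \big[setU/set0]_(k < N) ((c @^-1` [set (k : nat)]) `&` Q k).
Proof.
rewrite -(@bigcup_mkord _ N (fun k => (c @^-1` [set k]) `&` Q k)).
apply/seteqP; split=> [x Qx|x [k _ [/= <-]//]].
by exists (c x) => //; exact: cN.
Qed.

Let mI k : measurable ((c @^-1` [set k]) `&` Q k).
Proof. exact: measurableI. Qed.

Lemma measurable_glue : measurable [set x | Q (c x) x].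
Proof. by rewrite glueE; apply: bigsetU_measurable => k _; exact: mI. Qed.

Lemma prob_glue : m [set x | Q (c x) x] =
  \sum_(k < N) m ((c @^-1` [set (k : nat)]) `&` Q k).
Proof.
rewrite glueE; apply: (congr1 fine (y := EFin _)); rewrite -sumEFin.
transitivity (\sum_(k < N) mu ((c @^-1` [set (k : nat)]) `&` Q k))%E.
  apply: (@measure_semi_additive _ _ _ mu (fun k => (c @^-1` [set k]) `&` Q k)) => //.
    apply/trivIsetP => i j _ _ /eqP ij; apply/seteqP.
    by split=> // x [[/= ci _] [/= cj _]]; apply: ij; rewrite -ci.
  by apply: bigsetU_measurable => k _; exact: mI.
by apply: eq_bigr => k _; exact: prob_fineK.
Qed.

End labelling.

(** * Weak containment and products with a trivial action *)

Section times_trivial.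
Context (R : realType) (G : groupType) d (X : measurableType d)
  (mu : probability X R) (f : pmp_action G mu).
Context d' (Y : measurableType d') (nu : probability Y R).
Local Notation m A := (fine (mu A)).
Local Notation g := (diagonal_action f (trivial_action G nu)).

Lemma product_probabilityX (A : set X) (B : set Y) :
  measurable A -> measurable B ->
  product_probability mu nu (A `*` B) = (mu A * nu B)%E.
Proof. by move=> mA mB; rewrite /product_probability/= product_measure1E. Qed.

(** The product measure integrates over [X] first, whereas points are sampled in [Y]; uniqueness of
    the product measure exchanges the two orders. *)
Lemma product_probability_ysection (W : set (X * Y)) : measurable W ->
  product_probability mu nu W = (\int[nu]_y mu (ysection W y))%E.
Proof.
move=> mW; rewrite /product_probability/=.
rewrite (product_measure_unique (m1 := mu) (m2 := nu) (m' := mu \x^ nu)%E)//.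
by move=> A B mA mB; exact: product_measure2E.
Qed.

(** [f] is a factor of the product: cylinders realise all the measures exactly. *)
Lemma times_trivial_weakly_contains : weakly_contains g f.
Proof.
move=> n B mB S _ e e0; exists (fun i => B i `*` setT).
  by move=> i; exact: measurableX.
move=> i j a _.
have -> : (g a @` (B i `*` setT)) `&` (B j `*` setT) =
    ((f a @` B i) `&` B j) `*` setT.
  rewrite !image_act; apply/seteqP.
  by split=> [[x y] [[/= Bi _] [/= Bj _]]|[x y] [[/= Bi Bj] _]].
have mfB : measurable ((f a @` B i) `&` B j).
  by rewrite image_act; apply: measurableI => //; exact: measurable_preimage_act.
rewrite product_probabilityX// [X in (_ * X)%E]probability_setT mule1 subee ?abse0//.
exact: fin_num_measure.
Qed.

Lemma weakly_contains_times_trivial : countable [set: G] -> ergodic f ->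
  weakly_contains f (trivial_action G (bernoulli_prob (2^-1 : R))) ->
  weakly_contains f g.
Proof.
move=> cG ef fbool n B mB S /finite_seqP[s ->] e e0.
pose I : finType := ('I_n * 'I_n * seq_sub s)%type.
pose W (l : I) := (g (ssval l.2) @` B l.1.1) `&` B l.1.2.
have mW l : measurable (W l).
  rewrite /W image_act; apply: measurableI => //.
  exact: measurable_preimage_act.
pose phi l y := m (ysection (W l) y).
have mphi l : measurable_fun setT (phi l).
  by apply: measurableT_comp => //; exact: measurable_fun_ysection.
have phi01 l y : 0 <= phi l y <= 1.
  by rewrite prob_ge0 prob_le1//; exact: measurable_ysection.
have meanE l : \int[nu]_y phi l y = fine (product_probability mu nu (W l)).
  rewrite product_probability_ysection//; congr fine.
  apply: eq_integral => y _; rewrite /phi -prob_fineK//.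
  exact: measurable_ysection.
pose L : R := #|I|%:R + 1.
have L0 : 0 < L by rewrite ltr_wpDl.
(* With [K = 2 ^ N] this says [K * L < (K * (e / 4)) ^ 2], so that the bound of [exists_sample] puts
   each empirical mean within [e / 4] of its integral. *)
have [N NL] : exists N, L / (e / 4) ^+ 2 < (2 ^ N)%:R.
  exists (Num.bound (L / (e / 4) ^+ 2)).
  apply: lt_trans (archi_boundP _) _; first by rewrite divr_ge0 ?ltW ?exprn_gt0 ?divr_gt0.
  by rewrite ltr_nat ltn_expl.
set K := (2 ^ N)%N in NL.
have K0 : 0 < K%:R :> R by rewrite ltr0n expn_gt0.
have [t tK] := exists_sample nu mphi phi01 K.
have t_close l : `|(\sum_(k < K) phi l (t k)) / K%:R -
    fine (product_probability mu nu (W l))| < e / 4.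
  rewrite -meanE; set M := \int[nu]_y phi l y.
  have -> : (\sum_(k < K) phi l (t k)) / K%:R - M =
      (\sum_(k < K) (phi l (t k) - M)) / K%:R.
    rewrite sumrB sumr_const card_ord -[M *+ _]mulr_natr mulrBl mulfK//.
    by rewrite gt_eqF.
  rewrite normrM normfV (ger0_norm (ltW K0)) ltr_pdivrMr//.
  rewrite -(@ltr_pXn2r _ 2) ?nnegrE ?normr_ge0//; last by rewrite mulr_ge0// ltW// divr_gt0.
  rewrite real_normK ?num_real//.
  apply: (@le_lt_trans _ _ (K%:R * L)).
    apply: le_trans tK; rewrite (bigD1 l)//= lerDl; apply: sumr_ge0 => i _.
    exact: sqr_ge0.
  rewrite exprMn [_ * K%:R ^+ 2]mulrC expr2 -mulrA ltr_pM2l//.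
  by move: NL; rewrite ltr_pdivrMr ?exprn_gt0 ?divr_gt0.
pose P (lk : I * 'I_K) := ysection (W lk.1) (t lk.2).
have mP lk : measurable (P lk) by exact: measurable_ysection.
(* The errors of the [K] label classes will be summed, hence the division by [K]. *)
have e4K : 0 < e / 4 / K%:R by rewrite !divr_gt0.
have [c [mc cK cP cs]] := exists_mixing_labelling cG ef fbool N
  [seq a^-1%g | a <- s] mP e4K.
have mA i : measurable [set x | ysection (B i) (t (c x)) x].
  apply: (measurable_glue (Q := fun k => ysection (B i) (t k))) mc cK _ => k.
  exact: measurable_ysection.
exists (fun i => [set x | ysection (B i) (t (c x)) x]) => //.
move=> i j a sa.
pose l : I := (i, j, SeqSub sa).
have fA : measurable ((f a @` [set x | ysection (B i) (t (c x)) x]) `&`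
    [set x | ysection (B j) (t (c x)) x]).
  rewrite image_act; apply: measurableI; last exact: mA.
  by apply: measurable_preimage_act; exact: mA.
rewrite prob_fineK// (prob_fineK (product_probability mu nu) (mW l)).
rewrite -EFinB lte_fin.
(* [E] mediates between the witnesses and the empirical mean of [phi l]. Three errors of at most
   [e / 4] remain: witnesses to [E], [E] to the empirical mean, and the latter to the product
   measure. *)
pose E := [set x | ysection (W l) (t (c x)) x].
have mWt k : measurable (ysection (W l) (t k)) by exact: measurable_ysection.
have mE : measurable E by exact: (measurable_glue mc cK mWt).
have EW : `|m E - (\sum_(k < K) phi l (t k)) / K%:R| <= e / 4.
  rewrite (prob_glue mu mc cK mWt) mulr_suml -sumrB.
  apply: le_trans (ler_norm_sum _ _ _) _.
  apply: (@le_trans _ _ (\sum_(k < K) (e / 4 / K%:R))).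
    by apply: ler_sum => k _; apply/ltW; exact: (cP (l, k) k (ltn_ord k)).
  by rewrite sumr_const card_ord -[leLHS]mulr_natr divfK// gt_eqF.
(* The second coordinate is fixed by the action, so the two sets can differ only at points whose
   label changes under [a^-1]. *)
have FE : `|m ((f a @` [set x | ysection (B i) (t (c x)) x]) `&`
    [set x | ysection (B j) (t (c x)) x]) - m E| < e / 4.
  apply: le_lt_trans (prob_distY _ _ _) _ => //.
  apply: (@lt_le_trans _ _ (e / 4 / K%:R)); last first.
    by rewrite ler_pdivrMr// -[leLHS]mulr1 ler_pM2l ?divr_gt0// ler1n expn_gt0.
  apply: le_lt_trans (cs a^-1%g _); last by rewrite map_f.
  apply: prob_le; [exact: measurable_setY|exact: measurable_label_neq|].
  move=> x; apply: contraPP => /contrapT cx.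
  rewrite /E /W !image_act /ysection /= !inE /= cx.
  by case=> -[[? ?]] [].
have := t_close l; move: EW FE.
rewrite ler_norml !ltr_norml => /andP[? ?] /andP[? ?] /andP[? ?].
apply/andP; split; lra.
Qed.

End times_trivial.

(** * The two-point space as a factor of the unit interval *)

Section lower_half.
Context (R : realType).
Local Notation nu := (@lebesgue_unit_interval R).

Definition in_lower_half (y : borel_unit_interval R) : bool :=
  unit_interval_val y < 2^-1.

Lemma measurable_in_lower_half : measurable_fun setT in_lower_half.
Proof.
have mval : measurable_fun setT
    (@unit_interval_val R : borel_unit_interval R -> measurableTypeR R).
  by move=> _ B mB; rewrite setTI; exists B => //; rewrite setTI.
exact: measurable_fun_ltr.
Qed.

(** A probability on [bool] is determined by the mass of [true], here the length of [[0, 1/2[]. *)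
Lemma lebesgue_in_lower_half (B : set bool) :
  nu (in_lower_half @^-1` B) = bernoulli_prob (2^-1 : R) B.
Proof.
pose h : {mfun borel_unit_interval R >-> bool} :=
  HB.pack in_lower_half
    (isMeasurableFun.Build _ _ _ _ in_lower_half measurable_in_lower_half).
apply: (eq_bernoulli (P := distribution nu h)).
rewrite /distribution /pushforward /= /lebesgue_unit_interval.
rewrite (_ : _ @` _ = `[0, 2^-1[%classic).
  by rewrite lebesgue_measure_itv /= lte_fin invr_gt0 ltr0n oppr0 adde0.
apply/seteqP; split=> [_ [y /= y2 <-]|x].
  rewrite /= in_itv /=; have := set_valP y; rewrite /= in_itv /= => /andP[-> _].
  exact: y2.
rewrite /= in_itv /= => /andP[x0 x2].
have x01 : x \in `[0, 1]%classic.
  by rewrite inE /= in_itv /= x0 (le_trans (ltW x2))// invf_le1// ler1n.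
by exists (SigSub x01).
Qed.

End lower_half.

(** The two-point action is a factor of [times_I f] through the second coordinate: the cylinders
    over the [C i] have the same intersection measures as the [B i], so witnesses for the former
    serve for the latter. *)
Lemma times_I_weakly_contains_two_points (R : realType) (G : groupType) d
    (X : measurableType d) (mu : probability X R) (f : pmp_action G mu)
    d' (Z : measurableType d') (rho : probability Z R) (h : pmp_action G rho) :
  weakly_contains h (times_I f) ->
  weakly_contains h (trivial_action G (bernoulli_prob (2^-1 : R))).
Proof.
move=> hf n B mB S fS e e0.
pose C i := @in_lower_half R @^-1` B i.
have mC i : measurable (C i).
  by rewrite -[C i]setTI; exact: measurable_in_lower_half.
have mTC i : measurable ([set: X] `*` C i) by exact: measurableX.
have [A mA Ae] := hf n _ mTC S fS e e0.
exists A => // i j a Sa; have := Ae i j a Sa.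
congr (`|_ - _| < _)%E; rewrite !image_act.
transitivity (product_probability mu (@lebesgue_unit_interval R) (setT `*` (C i `&` C j))).
  by congr (_ _); apply/seteqP; split=> [[x y] [[_ ?] [_ ?]]|[x y] [_ [? ?]]].
rewrite product_probabilityX//; last exact: measurableI.
by rewrite probability_setT mul1e; exact: (lebesgue_in_lower_half R (B i `&` B j)).
Qed.

Theorem theorem3 (R : realType) (G : groupType) (hG : countable [set: G])
    (d : measure_display) (X : measurableType d) (hX : standard_borel R X)
    (mu : probability X R) (f : pmp_action G mu) (hf : ergodic f) :
  ~ strongly_ergodic f <-> weakly_equivalent f (times_I f).
Proof.
split=> [nsf|[ff _] [_]]; last by apply; exact: times_I_weakly_contains_two_points ff.
split; last exact: times_trivial_weakly_contains.
apply: weakly_contains_times_trivial => //.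
(* Since [f] is ergodic, the failure of strong ergodicity amounts, classically, to weak containment
   of the two-point action. *)
by apply: contrapT => nf; exact: nsf.
Qed.
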